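(* Let $\Phi:\mathbb{C}^n\to[-\infty,\infty)$ be upper semi-continuous. Given a non-empty open set $U\subset\mathbb{C}^n$ and a fixed Hermitian matrix $\mathcal{A}\in\mathbb{C}^{n\times n}$, take any real-valued function $g\in\mathcal{C}^2(U)$ whose complex Hessian satisfies $H^{\mathbb{C}}g\geq\mathcal{A}$ on $U$, i.e. $H^{\mathbb{C}}g(z)-\mathcal{A}$ is positive semidefinite for every $z\in U$. Let $q\geq 0$ be an integer and $u\in\mathit{PSH}_q(U)$, and suppose that the proper set of definition for the sup-convolution $[u+g]_U^\Phi$ has non-empty interior $W\neq\emptyset$. If the restriction of $[u+g]_U^\Phi$ to $W$ is upper semi-continuous, then $[u+g]_U^\Phi-h$ lies in $\mathit{PSH}_q(W)$ for every real-valued $h\in\mathcal{C}^2(W)$ whose complex Hessian satisfies $H^{\mathbb{C}}h\leq\mathcal{A}$ on $W$, i.e. $\mathcal{A}-H^{\mathbb{C}}h(z)$ is positive semidefinite for every $z\in W$.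
   Context: Definitions. Let $U\subset\mathbb{C}^n$ be open and $u:U\to[-\infty,\infty)$ upper semi-continuous. (i) $u$ is subpluriharmonic on $U$ if either $u\equiv-\infty$ on $U$, or for every compact ball $\overline{B}\subset U$ and every continuous plurisubharmonic function $h$ defined in a neighborhood of $\overline{B}$, the restriction of $u+h$ to $\overline{B}$ attains its maximum on the boundary $bB$. (ii) For an integer $0\leq q<n$, $u$ is $q$-plurisubharmonic on $U$ if it is subpluriharmonic on $U\cap\pi$ for every $(q+1)$-dimensional complex affine subspace $\pi$ of $\mathbb{C}^n$ (where $\pi$ is identified with $\mathbb{C}^{q+1}$). For integers $q\geq n$, by convention every upper semi-continuous function is $q$-plurisubharmonic. $\mathit{PSH}_q(U)$ denotes the set of all $q$-plurisubharmonic functions on $U$. (iii) The complex Hessian of a $\mathcal{C}^2$ function $\varphi$ is $H^{\mathbb{C}}\varphi=\left[\frac{\partial^2\varphi}{\partial z_k\partial\overline{z_\ell}}\right]_{k,\ell=1,\ldots,n}$. (iv) For a non-empty set $X\subset\mathbb{C}^n$ and upper semi-continuous functions $v:X\to[-\infty,\infty)$ and $\Phi:\mathbb{C}^n\to[-\infty,\infty)$, the sup-convolution is $v_X^\Phi(y):=\sup_{x\in X}\{v(x)+\Phi(y-x)\}\in[-\infty,\infty]$ for $y\in\mathbb{C}^n$. The proper set of definition for $v_X^\Phi$ is the set of those $y\in\mathbb{C}^n$ for which there is $\hat{x}\in X$ with $v_X^\Phi(y)=v(\hat{x})+\Phi(y-\hat{x})$. *)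

(* Defs.v *)
From HB Require Import structures.
From mathcomp Require Import all_boot all_order all_algebra.
From mathcomp Require Import complex.
From mathcomp Require Import all_classical all_reals all_analysis.

Set Implicit Arguments.
Unset Strict Implicit.
Unset Printing Implicit Defensive.

Import Order.TTheory GRing.Theory Num.Theory.
Import numFieldNormedType.Exports.

Local Open Scope classical_set_scope.
Local Open Scope complex_scope.
Local Open Scope sesquilinear_scope.
Local Open Scope ring_scope.

(* The topology of C = [R[i]] is that of its modulus. *)
HB.instance Definition _ (R : realType) :=
  PseudoPointedMetric.copy R[i] R[i]^o.

(* C^n is ['rV[R[i]]_n].  A function on a subset of C^n is a total function,
   of which only the values on that subset matter. *)

(* The library norm on ['rV[R[i]]_n] is the max norm (its balls are
   polydiscs), hence this explicit Euclidean norm; the topology is the same. *)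
Definition enorm (R : realType) (n : nat) (z : 'rV[R[i]]_n) : R :=
  Num.sqrt (\sum_(j < n) (complex.Re (z ord0 j) ^+ 2 +
                          complex.Im (z ord0 j) ^+ 2)).

Definition eclosed_ball (R : realType) (n : nat) (c : 'rV[R[i]]_n) (r : R) :
    set 'rV[R[i]]_n :=
  [set z | enorm (z - c) <= r].

Definition esphere (R : realType) (n : nat) (c : 'rV[R[i]]_n) (r : R) :
    set 'rV[R[i]]_n :=
  [set z | enorm (z - c) = r].

(* Upper semi-continuity, for the relative topology of X, of a function
   X -> [-oo, +oo[. *)
Definition usc_on (R : realType) (n : nat) (X : set 'rV[R[i]]_n)
    (u : 'rV[R[i]]_n -> \bar R) : Prop :=
  (forall x, X x -> (u x < +oo)%E) /\
  (forall x, X x -> forall a : R, (u x < a%:E)%E ->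
     \forall y \near within X (nbhs x), (u y < a%:E)%E).

(* Continuous plurisubharmonic functions V -> R, V open: sub-mean value
   inequality on the boundary of every closed affine disc contained in V. *)
Definition continuous_psh (R : realType) (n : nat) (V : set 'rV[R[i]]_n)
    (h : 'rV[R[i]]_n -> R) : Prop :=
  (forall z, V z -> {for z, continuous h}) /\
  (forall a b : 'rV[R[i]]_n,
     (forall l : R[i], `|l| <= 1 -> V (a + l *: b)) ->
     h a <= (2 * pi)^-1 *
       Rintegral (@lebesgue_measure R) `[0, 2 * pi]
         (fun t : R => h (a + (cos t +i* sin t) *: b))).

Definition subpluriharmonic (R : realType) (n : nat) (U : set 'rV[R[i]]_n)
    (u : 'rV[R[i]]_n -> \bar R) : Prop :=
  (forall z, U z -> u z = -oo%E) \/
  (forall (c : 'rV[R[i]]_n) (r : R), 0 < r -> eclosed_ball c r `<=` U ->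
   forall (V : set 'rV[R[i]]_n) (h : 'rV[R[i]]_n -> R),
     open V -> eclosed_ball c r `<=` V -> continuous_psh V h ->
     exists2 b, esphere c r b &
       forall x, eclosed_ball c r x ->
         (u x + (h x)%:E <= u b + (h b)%:E)%E).

(* A (q+1)-dimensional complex affine subspace is p + (row space of L), where
   the rows of L are orthonormal; it is identified with C^(q+1) through the
   isometry w |-> p + w *m L. *)
Definition psh_q (R : realType) (n : nat) (q : nat) (U : set 'rV[R[i]]_n)
    (u : 'rV[R[i]]_n -> \bar R) : Prop :=
  usc_on U u /\
  ((q < n)%N ->
   forall (p : 'rV[R[i]]_n) (L : 'M[R[i]]_(q.+1, n)), L \is unitarymx ->
     subpluriharmonic [set w : 'rV[R[i]]_q.+1 | U (p + w *m L)]
       (fun w => u (p + w *m L))).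

Definition line_fun (R : realType) (n : nat) (v : 'rV[R[i]]_n)
    (f : 'rV[R[i]]_n -> R) (z : 'rV[R[i]]_n) : R -> R :=
  fun t => f (z + t%:C *: v).

Definition rpartial (R : realType) (n : nat) (v : 'rV[R[i]]_n)
    (f : 'rV[R[i]]_n -> R) (z : 'rV[R[i]]_n) : R :=
  derive1 (line_fun v f z) 0.

Definition xdir (R : realType) (n : nat) (k : 'I_n) : 'rV[R[i]]_n :=
  delta_mx ord0 k.

Definition ydir (R : realType) (n : nat) (k : 'I_n) : 'rV[R[i]]_n :=
  (0 +i* 1) *: delta_mx ord0 k.

(* f is of class C^m on the open set U, in the 2n real coordinates. *)
Fixpoint Ck_on (R : realType) (n : nat) (m : nat) (U : set 'rV[R[i]]_n)
    (f : 'rV[R[i]]_n -> R) : Prop :=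
  (forall z, U z -> {for z, continuous f}) /\
  match m with
  | 0%N => True
  | m'.+1 =>
      forall v : 'rV[R[i]]_n,
        (exists k : 'I_n, v = xdir R k \/ v = ydir R k) ->
        (forall z, U z -> derivable (line_fun v f z) 0 1) /\
        Ck_on m' U (rpartial v f)
  end.

Definition cpartial (R : realType) (n : nat) (v : 'rV[R[i]]_n)
    (F : 'rV[R[i]]_n -> R[i]) (z : 'rV[R[i]]_n) : R[i] :=
  rpartial v (fun w => complex.Re (F w)) z +i*
  rpartial v (fun w => complex.Im (F w)) z.

(* Wirtinger: d/dz = (d/dx - i d/dy)/2, d/dzbar = (d/dx + i d/dy)/2. *)
Definition d_dz (R : realType) (n : nat) (k : 'I_n)
    (F : 'rV[R[i]]_n -> R[i]) (z : 'rV[R[i]]_n) : R[i] :=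
  (cpartial (xdir R k) F z - (0 +i* 1) * cpartial (ydir R k) F z) / 2.

Definition d_dzbar (R : realType) (n : nat) (k : 'I_n)
    (F : 'rV[R[i]]_n -> R[i]) (z : 'rV[R[i]]_n) : R[i] :=
  (cpartial (xdir R k) F z + (0 +i* 1) * cpartial (ydir R k) F z) / 2.

Definition complex_hessian (R : realType) (n : nat)
    (f : 'rV[R[i]]_n -> R) (z : 'rV[R[i]]_n) : 'M[R[i]]_n :=
  \matrix_(k < n, l < n) d_dz k (d_dzbar l (fun w => (f w)%:C)) z.

(* In the order of [R[i]], [0 <= x] means that x is real and nonnegative. *)
Definition psd_mx (R : realType) (n : nat) (M : 'M[R[i]]_n) : Prop :=
  M \is hermsymmx /\
  forall x : 'rV[R[i]]_n, 0 <= (x *m M *m x ^t*) ord0 ord0.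

Definition supconv (R : realType) (n : nat) (X : set 'rV[R[i]]_n)
    (Phi v : 'rV[R[i]]_n -> \bar R) (y : 'rV[R[i]]_n) : \bar R :=
  ereal_sup [set (v x + Phi (y - x)%R)%E | x in X].

Definition proper_set (R : realType) (n : nat) (X : set 'rV[R[i]]_n)
    (Phi v : 'rV[R[i]]_n -> \bar R) : set 'rV[R[i]]_n :=
  [set y | exists2 x, X x & supconv X Phi v y = (v x + Phi (y - x)%R)%E].

(* Main.v *)
Require Import Defs.
From mathcomp Require Import all_boot all_order all_algebra.
From mathcomp Require Import complex.
From mathcomp Require Import all_classical all_reals all_analysis.
From mathcomp Require Import ring lra.
Import Order.TTheory GRing.Theory Num.Theory.
Import numFieldNormedType.Exports.
Local Open Scope classical_set_scope.
Local Open Scope complex_scope.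
Local Open Scope ring_scope.

Set Implicit Arguments.
Unset Strict Implicit.
Unset Printing Implicit Defensive.

(** Fix a slice and a closed ball in it, let S be the sup-convolution and k the
    plurisubharmonic test function, and suppose that S - h + k has no maximum
    over the ball on the boundary.  Adding a small multiple e of the squared
    distance to the centre keeps an interior maximum, at a point w0 of the
    slice that corresponds to y0 in W ([strict_interior_max]).  Since y0 lies in
    the proper set, S y0 = u x0 + g x0 + Phi (y0 - x0) for some x0 in U, while
    S y >= u (y - t) + g (y - t) + Phi t with t = y0 - x0 for all y near y0.
    So the maximum is passed on to u: on the parallel slice through x0,
<<
      u (x) + [g (x) - h (x + t) + k (x + t) + e * (squared distance)]
>>
    has a local maximum at x0.  The bracket is strictly plurisubharmonic because
    the complex Hessian of g dominates A and that of h is dominated by A, and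
    this contradicts the subpluriharmonicity of u.

    The contradiction only concerns small spheres around x0, so g - h (. + t)
    may be replaced by its second-order Taylor polynomial, at the cost of
    (e / 2) times the squared distance to x0 ([quadratic_minorant]).  This is
    what keeps the analysis elementary: the sub-mean value inequality has to be
    known only for k plus a real quadratic polynomial, where the mean over a
    circle of direction b is computed explicitly and is governed by the sign of
    B (b, b) + B (i b, i b), twice the value at b of the Levi form
    ([continuous_psh_add_quadratic], [taylor_bil_levi]).

    The Taylor expansion is obtained by moving along the real coordinate axes
    one after the other and applying the mean value theorem on each segment.
    For a given order of the axes this produces the mixed derivatives
    in that order only; averaging over an order and the reversed one produces
    the symmetric sum of all second derivatives, so that Schwarz's theorem is
    bypassed ([taylor2]). *)

(** * Real coordinates *)

(** The 2n real directions are indexed by ['I_n * bool], the boolean telling the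
    imaginary direction from the real one; [rcoord] gives the dual coordinates. *)
Definition rdir (R : realType) (n : nat) (i : 'I_n * bool) : 'rV[R[i]]_n :=
  if i.2 then ydir R i.1 else xdir R i.1.

Definition rcoord (R : realType) (n : nat) (w : 'rV[R[i]]_n)
    (i : 'I_n * bool) : R :=
  if i.2 then complex.Im (w ord0 i.1) else complex.Re (w ord0 i.1).

(** Linearity over the reals, as a predicate since the scalars of ['rV[R[i]]_n]
    are complex. *)
Definition rlinear (R : realType) (n : nat) (f : 'rV[R[i]]_n -> R) : Prop :=
  forall (t : R) x y, f (t%:C *: x + y) = t * f x + f y.

Lemma rlinear_rcoord (R : realType) n (i : 'I_n * bool) :
  rlinear (fun w : 'rV[R[i]]_n => rcoord w i).
Proof.
move=> t x y; rewrite /rcoord !mxE; case: i => i [] /=;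
  case: (x ord0 i) => a b; case: (y ord0 i) => c d /=; ring.
Qed.

Lemma rlinear0 (R : realType) n (f : 'rV[R[i]]_n -> R) : rlinear f -> f 0 = 0.
Proof.
move=> lf; have := lf 1 0 0; rewrite scaler0 addr0 mul1r => /eqP.
by rewrite -subr_eq subrr eq_sym => /eqP.
Qed.

Lemma rlinearZ (R : realType) n (f : 'rV[R[i]]_n -> R) (t : R) x :
  rlinear f -> f (t%:C *: x) = t * f x.
Proof. by move=> lf; have := lf t x 0; rewrite rlinear0// !addr0. Qed.

Lemma rlinearD (R : realType) n (f : 'rV[R[i]]_n -> R) x y :
  rlinear f -> f (x + y) = f x + f y.
Proof. by move=> lf; have := lf 1 x y; rewrite scale1r mul1r. Qed.

Lemma rlinearN (R : realType) n (f : 'rV[R[i]]_n -> R) x :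
  rlinear f -> f (- x) = - f x.
Proof.
move=> lf; apply/eqP; rewrite -addr_eq0 -rlinearD// addrC subrr.
by rewrite rlinear0.
Qed.

Lemma rlinearB (R : realType) n (f : 'rV[R[i]]_n -> R) x y :
  rlinear f -> f (x - y) = f x - f y.
Proof. by move=> lf; rewrite rlinearD// rlinearN. Qed.

Lemma rlinear_sum (R : realType) n (f : 'rV[R[i]]_n -> R) (I : Type)
    (s : seq I) (P : pred I) (F : I -> 'rV[R[i]]_n) : rlinear f ->
  f (\sum_(i <- s | P i) F i) = \sum_(i <- s | P i) f (F i).
Proof.
move=> lf; apply: (big_morph f) => [x y|]; first exact: rlinearD.
exact: rlinear0.
Qed.

Lemma rcoord_dir (R : realType) n (i j : 'I_n * bool) :
  rcoord (rdir R i) j = (i == j)%:R.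
Proof.
case: i j => i bi [j bj]; rewrite /rcoord /rdir /xdir /ydir xpair_eqE /=.
case: bi; case: bj; rewrite !mxE eqxx /= [j == i]eq_sym; case: (i == j).
all: by rewrite /=; ring.
Qed.

Lemma rcoord_inj (R : realType) n (v w : 'rV[R[i]]_n) :
  (forall i, rcoord v i = rcoord w i) -> v = w.
Proof.
move=> vw; apply/rowP => k; have := vw (k, false); have := vw (k, true).
rewrite /rcoord /=; case: (v ord0 k) => a b; case: (w ord0 k) => c d /=.
by move=> -> ->.
Qed.

Lemma rcoord_sum (R : realType) n (s : seq ('I_n * bool)) (x : 'I_n * bool -> R) j :
  uniq s -> rcoord (\sum_(i <- s) (x i)%:C *: rdir R i) j = if j \in s then x j else 0.
Proof.
move=> us; rewrite (rlinear_sum _ _ _ (@rlinear_rcoord R n j)).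
under eq_bigr do rewrite (rlinearZ _ _ (@rlinear_rcoord R n j)) rcoord_dir.
case: ifP => js.
  rewrite (bigD1_seq j)//= eqxx mulr1 big1 ?addr0// => i ij.
  by rewrite (negbTE ij) mulr0.
rewrite big_seq big1// => i ins; case: eqP => [ij|]; last by rewrite mulr0.
by rewrite -ij ins in js.
Qed.

Lemma rcoordE (R : realType) n (w : 'rV[R[i]]_n) :
  \sum_i (rcoord w i)%:C *: rdir R i = w.
Proof.
apply: rcoord_inj => j; rewrite rcoord_sum ?mem_index_enum//.
exact: index_enum_uniq.
Qed.

Lemma rlinearE (R : realType) n (f : 'rV[R[i]]_n -> R) w : rlinear f ->
  f w = \sum_i rcoord w i * f (rdir R i).
Proof.
move=> lf; rewrite -[in LHS](rcoordE w) rlinear_sum//.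
by apply: eq_bigr => i _; rewrite rlinearZ.
Qed.

Lemma rlinear_comp (R : realType) m n (f : 'rV[R[i]]_n -> R) (L : 'M[R[i]]_(m, n)) :
  rlinear f -> rlinear (fun w => f (w *m L)).
Proof. by move=> lf t x y /=; rewrite mulmxDl -scalemxAl lf. Qed.

Lemma sqrt_leD (R : realType) (a b : R) : Num.sqrt (a ^+ 2 + b ^+ 2) <= `|a| + `|b|.
Proof.
rewrite -[leRHS]ger0_norm ?addr_ge0// -sqrtr_sqr ler_sqrt ?sqr_ge0//.
rewrite -[a ^+ 2]real_normK ?num_real// -[b ^+ 2]real_normK ?num_real//.
have := normr_ge0 a; have := normr_ge0 b; nra.
Qed.

(** The topology comes from the largest modulus of a complex coordinate, which is
    comparable with the largest absolute value of a real coordinate. *)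
Lemma nbhs_rcoord (R : realType) n (z : 'rV[R[i]]_n) (P : set 'rV[R[i]]_n) :
  nbhs z P <->
  exists2 d : R, 0 < d &
    forall w, (forall i, `|rcoord (w - z) i| < d) -> P w.
Proof.
split=> [/nbhs_ballP[e e0 eP]|[d d0 dP]].
  move: e0; rewrite /= ltcE => /andP[/eqP /= Ime Ree].
  exists (complex.Re e / 2) => [|w we]; first by rewrite divr_gt0.
  apply: eP; split; first by rewrite ltcE Ime eqxx.
  move=> i j; rewrite ord1 /ball /= normc_def ltcE /= Ime eqxx/=.
  apply: le_lt_trans (sqrt_leD _ _) _.
  have := we (j, false); have := we (j, true); rewrite /rcoord /= !mxE.
  case: (z ord0 j) => a b; case: (w ord0 j) => c d /=.
  rewrite [`|a - c|]distrC [`|b - d|]distrC; lra.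
apply/nbhs_ballP; exists d%:C => /=; first by rewrite ltcE /= eqxx.
move=> w [_ we]; apply: dP => -[j b].
have := we ord0 j; rewrite /ball /= normc_def ltcE /= eqxx /= /rcoord !mxE.
case: (z ord0 j) => a1 b1; case: (w ord0 j) => c1 d1 /=.
apply: le_lt_trans; rewrite -sqrtr_sqr; case: b => /=; rewrite ler_sqrt;
  rewrite ?addr_ge0 ?sqr_ge0 //; have := sqr_ge0 (a1 - c1);
  have := sqr_ge0 (b1 - d1); lra.
Qed.

Lemma cvg_rcoord (R : realType) (T : Type) n (F : set_system T) (f : T -> 'rV[R[i]]_n)
    (z : 'rV[R[i]]_n) : Filter F ->
  (forall i, rcoord (f x) i @[x --> F] --> rcoord z i) -> f x @[x --> F] --> z.
Proof.
move=> FF cf P /nbhs_rcoord[d d0 dP]; rewrite /nbhs /=.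
have H : \forall x \near F, forall i, `|rcoord (f x) i - rcoord z i| < d.
  apply: filter_forall => i.
  by have /cvgr_distC_lt := cf i; exact.
near=> x; apply: dP => i.
rewrite (rlinearB _ _ (@rlinear_rcoord R n i)).
by move: i; near: x.
Unshelve. all: by end_near. Qed.

Lemma rcoord_continuous (R : realType) n (i : 'I_n * bool) :
  continuous (fun w : 'rV[R[i]]_n => rcoord w i).
Proof.
move=> z P /nbhs_ballP[e /= e0 eP]; apply/nbhs_rcoord; exists e => // w wz.
apply: eP; rewrite /ball /= distrC -(rlinearB _ _ (@rlinear_rcoord R n i)).
exact: wz.
Qed.

Lemma cvg_sumr (R : realType) (T I : Type) (F : set_system T) (s : seq I)
    (f : I -> T -> R) (a : I -> R) : Filter F ->
  (forall i, f i x @[x --> F] --> a i) ->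
  \sum_(i <- s) f i x @[x --> F] --> \sum_(i <- s) a i.
Proof. by move=> FF fa; apply: cvg_big => //; exact: add_continuous. Qed.

Lemma rlinear_continuous (R : realType) n (f : 'rV[R[i]]_n -> R) :
  rlinear f -> continuous f.
Proof.
move=> lf.
have [c ->] : exists c, f = fun w => \sum_i rcoord w i * c i.
  by exists (fun i => f (rdir R i)); apply/funext => w; exact: rlinearE.
move=> z; apply: (@cvg_sumr _ _ _ (nbhs z)) => i.
apply: (@cvgMr_tmp _ _ (nbhs z)).
exact: rcoord_continuous.
Qed.

(** * Euclidean balls and maxima of upper semi-continuous functions *)

Lemma sum_rcoord (R : realType) n (F : 'I_n * bool -> R) :
  \sum_i F i = \sum_(j < n) (F (j, false) + F (j, true)).
Proof.
rewrite (eq_bigr (fun i : 'I_n * bool => F (i.1, i.2))); last by case.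
rewrite -(pair_bigA _ (fun j b => F (j, b))) /=.
by apply: eq_bigr => j _; rewrite big_bool addrC.
Qed.

Lemma enormE (R : realType) n (w : 'rV[R[i]]_n) :
  enorm w = Num.sqrt (\sum_i rcoord w i ^+ 2).
Proof. by rewrite sum_rcoord. Qed.

Lemma enorm_sqr (R : realType) n (w : 'rV[R[i]]_n) :
  enorm w ^+ 2 = \sum_i rcoord w i ^+ 2.
Proof. by rewrite enormE sqr_sqrtr// sumr_ge0// => i _; exact: sqr_ge0. Qed.

Lemma enorm_ge0 (R : realType) n (w : 'rV[R[i]]_n) : 0 <= enorm w.
Proof. exact: sqrtr_ge0. Qed.

Lemma rcoord_le_enorm (R : realType) n (w : 'rV[R[i]]_n) i :
  `|rcoord w i| <= enorm w.
Proof.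
rewrite enormE -sqrtr_sqr ler_sqrt; last first.
  by rewrite sumr_ge0// => j _; exact: sqr_ge0.
by rewrite (bigD1 i)//= lerDl sumr_ge0// => j _; exact: sqr_ge0.
Qed.

Lemma enorm_sqr_continuous (R : realType) n (c : 'rV[R[i]]_n) :
  continuous (fun w : 'rV[R[i]]_n => enorm (w - c) ^+ 2).
Proof.
move=> z.
rewrite (_ : (fun w => _) =
    fun w : 'rV[R[i]]_n =>
      \sum_i (rcoord w i - rcoord c i) * (rcoord w i - rcoord c i)); last first.
  apply/funext => w; rewrite enorm_sqr; apply: eq_bigr => i _.
  by rewrite (rlinearB _ _ (@rlinear_rcoord R n i)) expr2.
have cB i : (rcoord (w : 'rV[R[i]]_n) i - rcoord c i) @[w --> z] --> rcoord z i - rcoord c i.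
  have cz := @rcoord_continuous R n i z.
  exact: cvgB cz (cvg_cst _).
apply: (@cvg_sumr _ _ _ (nbhs z)) => i.
exact: cvgM (cB i) (cB i).
Qed.

Lemma closed_eclosed_ball (R : realType) n (c : 'rV[R[i]]_n) (r : R) :
  0 <= r -> closed (eclosed_ball c r).
Proof.
move=> r0.
rewrite (_ : eclosed_ball c r =
    (fun w : 'rV[R[i]]_n => enorm (w - c) ^+ 2) @^-1` [set t | t <= r ^+ 2]); last first.
  by apply/seteqP; split => w /=; rewrite /eclosed_ball /= ler_sqr ?nnegrE ?enorm_ge0.
apply: closed_comp; last exact: closed_le.
by move=> w _; exact: enorm_sqr_continuous.
Qed.

Lemma closed_esphere (R : realType) n (c : 'rV[R[i]]_n) (r : R) :
  0 <= r -> closed (esphere c r).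
Proof.
move=> r0.
rewrite (_ : esphere c r =
    (fun w : 'rV[R[i]]_n => enorm (w - c) ^+ 2) @^-1` [set t | t = r ^+ 2]); last first.
  apply/seteqP; split => w /=; rewrite /esphere /=; first by move=> ->.
  by move=> /eqP; rewrite eqrXn2 ?enorm_ge0// => /eqP.
apply: closed_comp; last exact: closed_eq.
by move=> w _; exact: enorm_sqr_continuous.
Qed.

(** The closed ball lies in the image of a compact box of ['rV[R]_(2n)] under
    the identification of real coordinates. *)
Lemma compact_eclosed_ball (R : realType) n (c : 'rV[R[i]]_n) (r : R) :
  0 <= r -> compact (eclosed_ball c r).
Proof.
move=> r0.
pose m := #|{: 'I_n * bool}|.
pose box := [set x : 'rV[R]_m |
  forall k, `[rcoord c (enum_val k) - r, rcoord c (enum_val k) + r]%classic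
    (x ord0 k)].
pose f (x : 'rV[R]_m) : 'rV[R[i]]_n :=
  \sum_i (x ord0 (enum_rank i))%:C *: rdir R i.
have fE x i : rcoord (f x) i = x ord0 (enum_rank i).
  by rewrite rcoord_sum ?mem_index_enum ?index_enum_uniq.
have cbox : compact box.
  apply: (@rV_compact R m (fun k =>
    `[rcoord c (enum_val k) - r, rcoord c (enum_val k) + r]%classic)) => k.
  exact: segment_compact.
have cf : continuous f.
  move=> x; apply: (@cvg_rcoord _ _ _ (nbhs x)) => i; rewrite fE.
  under eq_cvg do rewrite fE.
  exact: coord_continuous.
have cim : compact (f @` box).
  by apply: continuous_compact => //; apply: continuous_subspaceT.
apply: (subclosed_compact _ cim); first exact: closed_eclosed_ball.
move=> w wr; exists (\row_k rcoord w (enum_val k)).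
  move=> k; rewrite mxE /= in_itv /=.
  have := le_trans (rcoord_le_enorm (w - c) (enum_val k)) wr.
  by rewrite (rlinearB _ _ (@rlinear_rcoord R n _)) ler_distl.
by apply: rcoord_inj => i; rewrite fE mxE enum_rankK.
Qed.

Lemma compact_esphere (R : realType) n (c : 'rV[R[i]]_n) (r : R) :
  0 <= r -> compact (esphere c r).
Proof.
move=> r0; apply: (@subclosed_compact _ _ (eclosed_ball c r)).
- exact: closed_esphere.
- exact: compact_eclosed_ball.
by move=> w; rewrite /esphere /eclosed_ball /= => ->.
Qed.

Lemma esphere_nonempty (R : realType) n (c : 'rV[R[i]]_n.+1) (r : R) :
  0 <= r -> esphere c r !=set0.
Proof.
move=> r0; exists (c + r%:C *: rdir R (ord0, false)).
rewrite /esphere /= addrAC subrr add0r enormE (bigD1 (ord0, false))//= big1.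
  rewrite (rlinearZ _ _ (@rlinear_rcoord R _ _)) rcoord_dir eqxx mulr1 addr0.
  by rewrite sqrtr_sqr ger0_norm.
move=> i i0; rewrite (rlinearZ _ _ (@rlinear_rcoord R _ _)) rcoord_dir.
by rewrite eq_sym (negbTE i0) mulr0 expr0n.
Qed.

Lemma lte_real_between (R : realType) (x y : \bar R) : (x < y)%E ->
  exists a : R, (x < a%:E < y)%E.
Proof.
case: x => [s||]; case: y => [t||] //.
- rewrite lte_fin => st; exists ((s + t) / 2).
  by rewrite !lte_fin midf_lt//= midf_lt.
- by move=> _; exists (s + 1); rewrite lte_fin ltrDl ltr01 ltry.
- by move=> _; exists (t - 1); rewrite lte_fin gtrDl oppr_lt0 ltr01 ltNyr.
- by move=> _; exists 0; rewrite ltNyr ltry.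
Qed.

(** The superlevel sets of [u] in [K] at levels below the supremum form a filter
    base; a cluster point at which the supremum were not attained would have a
    neighbourhood avoiding one of these sets. *)
Lemma usc_on_max (R : realType) n (X K : set 'rV[R[i]]_n) (u : 'rV[R[i]]_n -> \bar R) :
  usc_on X u -> K `<=` X -> compact K -> K !=set0 ->
  exists2 b, K b & forall x, K x -> (u x <= u b)%E.
Proof.
move=> [_ uscu] KX cK [x0 Kx0].
pose M := ereal_sup (u @` K).
have ubM x : K x -> (u x <= M)%E by move=> Kx; apply: ereal_sup_ubound; exists x.
apply: contrapT => nomax.
have ltM x : K x -> (u x < M)%E.
  move=> Kx; rewrite lt_neqAle ubM// andbT; apply/eqP => uxM.
  by apply: nomax; exists x => // y Ky; rewrite uxM; exact: ubM.
pose F : set_system 'rV[R[i]]_n :=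
  filter_from [set a : \bar R | (a < M)%E] (fun a => K `&` [set x | (a < u x)%E]).
have PF : ProperFilter F.
  apply: filter_from_proper; last first.
    move=> a aM; have [_ [x Kx <-] ax] := ereal_sup_gt aM.
    by exists x.
  apply: filter_from_filter; first by exists (u x0); exact: ltM.
  move=> a b /= aM bM; exists (Order.max a b); first by rewrite /= gt_max aM bM.
  by move=> x [Kx /=]; rewrite gt_max => /andP[? ?].
have FK : F K by exists (u x0); [exact: ltM | move=> x []].
have [x [Kx clx]] := cK _ PF FK.
have [a /andP[xa aM]] := lte_real_between (ltM x Kx).
have nb := uscu x (KX _ Kx) a xa.
have [|y [[Ky ay] /(_ (KX _ Ky)) ya]] := clx (K `&` [set x | (a%:E < u x)%E]) _ _ nb.
  by exists a%:E.
by have := lt_trans ay ya; rewrite ltxx.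
Qed.

(** * Second-order Taylor expansion *)

Lemma rdir_coordinate (R : realType) n (i : 'I_n * bool) :
  exists k : 'I_n, rdir R i = xdir R k \/ rdir R i = ydir R k.
Proof. by exists i.1; rewrite /rdir; case: i.2; [right|left]. Qed.

Lemma line_fun_is_derive (R : realType) n (v : 'rV[R[i]]_n) f z (t : R) :
  derivable (line_fun v f (z + t%:C *: v)) 0 1 ->
  is_derive t 1 (line_fun v f z) (rpartial v f (z + t%:C *: v)).
Proof.
have E : (fun h : R => h^-1 *: (line_fun v f z (h *: 1 + t) - line_fun v f z t)) =
  (fun h : R => h^-1 *: (line_fun v f (z + t%:C *: v) (h *: 1 + 0) -
     line_fun v f (z + t%:C *: v) 0)).
  apply/funext => h; rewrite /line_fun addr0 scale0r addr0.
  by rewrite rmorphD /= scalerDl addrA addrAC.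
move=> dv; split; first by rewrite /derivable E.
by rewrite /rpartial derive1E /derive E.
Qed.

(** Mean value inequality at 0, on whichever side [x] lies. *)
Lemma is_derive_increment (R : realType) (f df : R -> R) (x e : R) :
  (forall s : R, `|s| <= `|x| -> is_derive s 1 f (df s)) ->
  (forall s : R, `|s| <= `|x| -> `|df s| <= e) ->
  `|f x - f 0| <= e * `|x|.
Proof.
move=> dF le; have cont a b : (forall s : R, a <= s <= b -> `|s| <= `|x|) ->
    {within `[a, b], continuous f}.
  move=> H; apply: derivable_within_continuous => s; rewrite in_itv /= => /H /dF.
  by case.
have [x0|x0] := leP 0 x.
  have nx s : 0 <= s <= x -> `|s| <= `|x|.
    by move=> /andP[s0 sx]; rewrite !ger0_norm.
  have [s||c] := @MVT_segment R f df 0 x x0; last 2 first.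
  - exact: cont.
  - rewrite in_itv /= => /nx cx ->; rewrite subr0 normrM.
    by rewrite ler_wpM2r// le.
  by rewrite in_itv /= => /andP[/ltW s0 /ltW sx]; apply: dF; rewrite nx// s0.
have nx s : x <= s <= 0 -> `|s| <= `|x|.
  by move=> /andP[sx s0]; rewrite !ler0_norm ?lerN2// ltW.
have [s||c] := @MVT_segment R f df x 0 (ltW x0); last 2 first.
- exact: cont.
- rewrite in_itv /= => /nx cx; rewrite distrC => ->; rewrite sub0r normrM normrN.
  by rewrite ler_wpM2r// le.
by rewrite in_itv /= => /andP[/ltW s0 /ltW sx]; apply: dF; rewrite nx// s0.
Qed.

Definition rcomb (R : realType) n (s : seq ('I_n * bool)) (x : 'I_n * bool -> R) :
    'rV[R[i]]_n :=
  \sum_(i <- s) (x i)%:C *: rdir R i.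

Lemma rcoord_rcomb_cons (R : realType) n (i : 'I_n * bool) s (x : 'I_n * bool -> R)
    (m t : R) j : uniq (i :: s) -> (forall k, `|x k| <= m) -> `|t| <= m ->
  `|rcoord (rcomb s x + t%:C *: rdir R i) j| <= m.
Proof.
move=> /=/andP[iNs us] xm tm; have m0 : 0 <= m by apply: le_trans tm.
rewrite (rlinearD _ _ (@rlinear_rcoord R n j)) (rlinearZ _ _ (@rlinear_rcoord R n j)).
rewrite rcoord_sum// rcoord_dir; case: eqP => [<-|_].
  by rewrite (negbTE iNs) add0r mulr1.
by rewrite mulr0 addr0; case: ifP => // _; rewrite normr0.
Qed.

Definition partial1 (R : realType) n (f : 'rV[R[i]]_n -> R) (z : 'rV[R[i]]_n) i : R :=
  rpartial (rdir R i) f z.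

(** The derivative in direction [j] is taken first. *)
Definition partial2 (R : realType) n (f : 'rV[R[i]]_n -> R) (z : 'rV[R[i]]_n) i j : R :=
  rpartial (rdir R i) (rpartial (rdir R j) f) z.

Lemma Ck_on_partial1 (R : realType) n (m : nat) U (f : 'rV[R[i]]_n -> R) i :
  Ck_on m.+1 U f -> Ck_on m U (rpartial (rdir R i) f).
Proof. by move=> [_ /(_ _ (rdir_coordinate R i))[]]. Qed.

Lemma Ck_on_derivable (R : realType) n (m : nat) U (f : 'rV[R[i]]_n -> R) i z :
  Ck_on m.+1 U f -> U z -> derivable (line_fun (rdir R i) f z) 0 1.
Proof. by move=> [_ /(_ _ (rdir_coordinate R i))[+ _]]; apply. Qed.

Lemma nbhs_continuous (R : realType) n (f : 'rV[R[i]]_n -> R) z (e : R) :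
  {for z, continuous f} -> 0 < e ->
  exists2 d : R, 0 < d & forall w, (forall i, `|rcoord (w - z) i| < d) ->
    `|f w - f z| <= e.
Proof.
move=> fz e0; have : nbhs z [set w | `|f w - f z| <= e].
  by have /cvgr_distC_le := fz; apply.
by move=> /nbhs_rcoord.
Qed.

(** Comparison of [f] with a scalar function [p] along one coordinate segment:
    the mean value inequality for their difference.  Both Taylor estimates
    take [p] to be the expected polynomial in the last coordinate. *)
Lemma coordinate_increment (R : realType) n (U : set 'rV[R[i]]_n) f y i
    (p dp : R -> R) (x e : R) :
  Ck_on 1 U f ->
  (forall t : R, `|t| <= `|x| -> U (y + t%:C *: rdir R i)) ->
  (forall t : R, is_derive t 1 p (dp t)) ->
  (forall t : R, `|t| <= `|x| -> `|partial1 f (y + t%:C *: rdir R i) i - dp t| <= e) ->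
  `|(f (y + x%:C *: rdir R i) - p x) - (f y - p 0)| <= e * `|x|.
Proof.
move=> Cf inU dp_p le.
have := @is_derive_increment R (fun t : R => line_fun (rdir R i) f y t - p t)
  (fun t : R => partial1 f (y + t%:C *: rdir R i) i - dp t) x e.
rewrite /= {2 3}/line_fun scale0r addr0; apply => // t tx.
have dt : is_derive t 1 (line_fun (rdir R i) f y) (partial1 f (y + t%:C *: rdir R i) i).
  by apply: line_fun_is_derive; exact: Ck_on_derivable Cf (inU _ tx).
exact: is_deriveB.
Qed.

Lemma is_derive_linear (R : realType) (b t : R) :
  is_derive t 1 (fun t : R => b * t) b.
Proof.
by apply: is_derive_eq; rewrite /GRing.scale /= mulr1.
Qed.

(** Differentiability from continuous partial derivatives: the axes of [s] are
    followed one at a time, each contributing its own increment. *)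
Lemma taylor1 (R : realType) n (U : set 'rV[R[i]]_n) f z s :
  open U -> U z -> Ck_on 1 U f -> uniq s ->
  forall e : R, 0 < e -> exists2 d : R, 0 < d &
    forall (m : R) (x : 'I_n * bool -> R), 0 <= m < d -> (forall i, `|x i| <= m) ->
      `|f (z + rcomb s x) - f z - \sum_(i <- s) partial1 f z i * x i| <= e * m.
Proof.
move=> oU Uz Cf; elim: s => [_ e e0|i s IH us e e0].
  exists 1 => // m x /andP[m0 _] _.
  by rewrite /rcomb !big_nil addr0 subrr subr0 normr0 mulr_ge0// ltW.
have [|d1 d10 IHd] := IH _ (e / 2) (divr_gt0 e0 (ltr0n _ 2)).
  by case/andP: us.
have [d2 d20 Ud] := (nbhs_rcoord _ _).1 (open_nbhs_nbhs (conj oU Uz)).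
have [d3 d30 cd] := nbhs_continuous ((Ck_on_partial1 i Cf).1 z Uz) (divr_gt0 e0 (ltr0n _ 2)).
exists (Num.min d1 (Num.min d2 d3)); first by rewrite !lt_min d10 d20.
move=> m x; rewrite !lt_min => /and4P[m0 md1 md2 md3] xm.
have near (t : R) j : `|t| <= `|x i| ->
    `|rcoord (z + rcomb s x + t%:C *: rdir R i - z) j| <= m.
  move=> tx; rewrite -(addrA z) (addrC z) addrK.
  by apply: rcoord_rcomb_cons => //; apply: le_trans (xm i).
have incr : `|(f (z + rcomb s x + (x i)%:C *: rdir R i) - partial1 f z i * x i) -
    (f (z + rcomb s x) - partial1 f z i * 0)| <= e / 2 * m.
  apply: le_trans (coordinate_increment (dp := fun=> partial1 f z i) (e := e / 2) Cf _ _ _) _.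
  - by move=> t tx; apply: Ud => j; exact: le_lt_trans (near _ _ tx) md2.
  - by move=> t; exact: is_derive_linear.
  - by move=> t tx; apply: cd => j; exact: le_lt_trans (near _ _ tx) md3.
  - by rewrite ler_wpM2l// divr_ge0// ltW.
have := IHd m x; rewrite m0 md1 => /(_ isT xm) {}IHd.
rewrite mulr0 subr0 in incr.
rewrite {1}/rcomb !big_cons -/(rcomb s x) [_ *: _ + _]addrC addrA.
set a := f _ in incr *; set b := f (z + rcomb s x) in incr IHd.
set S := \sum_(_ <- _) _ in IHd *.
rewrite (_ : a - f z - _ = (a - partial1 f z i * x i - b) + (b - f z - S)); last by ring.
by apply: le_trans (ler_normD _ _) _; lra.
Qed.

(** The second-order term found by following the axes of [s], from the last one
    to the first: only the [a j i] with [i] not after [j] appear. *)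
Fixpoint quadratic_path (R : realType) (I : Type) (a : I -> I -> R) (s : seq I)
    (x : I -> R) : R :=
  if s is i :: s' then
    x i * (\sum_(j <- s') a j i * x j) + a i i * x i ^+ 2 / 2 +
    quadratic_path a s' x
  else 0.

Lemma quadratic_path_rcons (R : realType) (I : Type) (a : I -> I -> R) s i x :
  quadratic_path a (rcons s i) x =
  quadratic_path a s x + x i * (\sum_(j <- s) a i j * x j) + a i i * x i ^+ 2 / 2.
Proof.
elim: s => [|j s IH] /=; first by rewrite !big_nil; ring.
rewrite IH -cats1 big_cat /= big_seq1 !big_cons; ring.
Qed.

(** A path and its reversal together see each ordered pair of directions exactly
    once, and each diagonal term twice with weight one half. *)
Lemma quadratic_path_rev (R : realType) (I : Type) (a : I -> I -> R) s x :
  quadratic_path a s x + quadratic_path a (rev s) x =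
  \sum_(i <- s) \sum_(j <- s) a i j * x i * x j.
Proof.
elim: s => [|i s IH] /=; first by rewrite big_nil addr0.
rewrite rev_cons quadratic_path_rcons !big_cons.
under [X in _ = _ + X]eq_bigr do rewrite big_cons.
rewrite big_split /= -IH.
have -> : \sum_(j <- rev s) a i j * x j = \sum_(j <- s) a i j * x j.
  by rewrite big_rev.
rewrite !mulr_sumr.
have -> : \sum_(j <- s) a i j * x i * x j = \sum_(j <- s) x i * (a i j * x j).
  by apply: eq_bigr => j _; ring.
have -> : \sum_(j <- s) a j i * x j * x i = \sum_(j <- s) x i * (a j i * x j).
  by apply: eq_bigr => j _; ring.
by field.
Qed.

(** Along the segment in direction [i], the derivative of [f] is the partial
    derivative in direction [i], which [taylor1] expands to first order around [z];
    integrating this expansion in the coordinate [i] gives the quadratic term. *)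
Lemma taylor2_path (R : realType) n (U : set 'rV[R[i]]_n) f z s :
  open U -> U z -> Ck_on 2 U f -> uniq s ->
  forall e : R, 0 < e -> exists2 d : R, 0 < d &
    forall (m : R) (x : 'I_n * bool -> R), 0 <= m < d -> (forall i, `|x i| <= m) ->
      `|f (z + rcomb s x) - f z - \sum_(i <- s) partial1 f z i * x i -
        quadratic_path (partial2 f z) s x| <= e * m ^+ 2.
Proof.
move=> oU Uz Cf; elim: s => [_ e e0|i s IH us e e0].
  exists 1 => // m x /andP[m0 _] _.
  by rewrite /rcomb !big_nil addr0 subrr !subr0 normr0 mulr_ge0// ?sqr_ge0// ltW.
have Cf1 : Ck_on 1 U f.
  case: Cf => cf Df; split; first exact: cf.
  move=> v /Df[dv [cv _]]; split; first exact: dv.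
  by split; first exact: cv.
have e20 : 0 < e / 2 by rewrite divr_gt0.
have [|d1 d10 IHd] := IH _ (e / 2) e20; first by case/andP: us.
have [d2 d20 Ud] := (nbhs_rcoord _ _).1 (open_nbhs_nbhs (conj oU Uz)).
have [d3 d30 Td] := taylor1 oU Uz (Ck_on_partial1 i Cf) us e20.
exists (Num.min d1 (Num.min d2 d3)); first by rewrite !lt_min d10 d20.
move=> m x; rewrite !lt_min => /and4P[m0 md1 md2 md3] xm.
have near (t : R) j : `|t| <= `|x i| ->
    `|rcoord (z + rcomb s x + t%:C *: rdir R i - z) j| <= m.
  move=> tx; rewrite -(addrA z) (addrC z) addrK.
  by apply: rcoord_rcomb_cons => //; apply: le_trans (xm i).
pose l := partial1 f z i + \sum_(j <- s) partial2 f z j i * x j.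
have incr : `|(f (z + rcomb s x + (x i)%:C *: rdir R i) -
      (l * x i + partial2 f z i i / 2 * x i ^+ 2)) -
    (f (z + rcomb s x) - (l * 0 + partial2 f z i i / 2 * 0 ^+ 2))| <= e / 2 * m * `|x i|.
  apply: (coordinate_increment (p := fun t : R => l * t + partial2 f z i i / 2 * t ^+ 2)
    (dp := fun t => l + partial2 f z i i * t) Cf1).
  - by move=> t tx; apply: Ud => j; exact: le_lt_trans (near _ _ tx) md2.
  - move=> t; apply: is_derive_eq; rewrite /GRing.scale /=; lra.
  - move=> t tx.
    (* The point of the segment has coordinates [xt], so that [taylor1] applies
       to it along the axes [i :: s]. *)
    pose xt j := if j == i then t else x j.
    have Es (F : _ -> R) : \sum_(j <- s) F j * xt j = \sum_(j <- s) F j * x j.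
      rewrite big_seq [RHS]big_seq; apply: eq_bigr => j js; rewrite /xt.
      by case: eqP => // ji; move: us; rewrite /= -ji js.
    have := Td m xt; rewrite m0 md3 => /(_ isT).
    have -> : rcomb (i :: s) xt = rcomb s x + t%:C *: rdir R i.
      rewrite /rcomb big_cons addrC /xt eqxx; congr (_ + _).
      rewrite big_seq [RHS]big_seq; apply: eq_bigr => j js.
      by case: eqP => // ji; move: us; rewrite /= -ji js.
    rewrite big_cons Es /xt eqxx addrA => Td'.
    rewrite /partial1 /l [X in `|X|](_ : _ =
        rpartial (rdir R i) f (z + rcomb s x + t%:C *: rdir R i) -
        rpartial (rdir R i) f z -
        (partial1 (rpartial (rdir R i) f) z i * t +
         \sum_(j <- s) partial1 (rpartial (rdir R i) f) z j * x j)).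
      apply: Td' => j; case: eqP => // _; exact: le_trans tx (xm i).
    rewrite /partial1 /partial2; ring.
have {}incr := le_trans incr (ler_wpM2l (mulr_ge0 (ltW e20) m0) (xm i)).
have := IHd m x; rewrite m0 md1 => /(_ isT xm) {}IHd.
rewrite /= {1}/rcomb !big_cons -/(rcomb s x) [_ *: _ + _]addrC addrA.
set a := f (_ + _ + _) in incr *; set b := f (z + rcomb s x) in incr IHd.
rewrite /l in incr.
set S := \sum_(_ <- _) partial1 _ _ _ * _ in IHd *.
set S2 := \sum_(_ <- _) partial2 _ _ _ _ * _ in incr *.
set Q := quadratic_path _ _ _ in IHd *.
set c := partial1 f z i in incr *; set h := partial2 f z i i in incr *.
rewrite (_ : _ - _ = (a - ((c + S2) * x i + h / 2 * x i ^+ 2) -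
    (b - ((c + S2) * 0 + h / 2 * 0 ^+ 2))) + (b - f z - S - Q)); last by field; rewrite ?pnatr_eq0.
by apply: le_trans (ler_normD _ _) _; lra.
Qed.

Definition taylor_lin (R : realType) n (f : 'rV[R[i]]_n -> R) z w : R :=
  \sum_i partial1 f z i * rcoord w i.

Definition taylor_bil (R : realType) n (f : 'rV[R[i]]_n -> R) z v w : R :=
  2^-1 * \sum_i \sum_j partial2 f z i j * rcoord v i * rcoord w j.

(** The average of the expansions along an order of the axes and its reversal. *)
Lemma taylor2 (R : realType) n (U : set 'rV[R[i]]_n) f z :
  open U -> U z -> Ck_on 2 U f ->
  forall e : R, 0 < e -> exists2 d : R, 0 < d &
    forall (m : R) w, 0 <= m < d -> (forall i, `|rcoord w i| <= m) ->
      `|f (z + w) - f z - taylor_lin f z w - taylor_bil f z w w| <= e * m ^+ 2.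
Proof.
move=> oU Uz Cf e e0; pose s := index_enum ('I_n * bool)%type.
have us : uniq s by exact: index_enum_uniq.
have [d1 d10 T1] := taylor2_path oU Uz Cf us e0.
have urs : uniq (rev s) by rewrite rev_uniq.
have [d2 d20 T2] := taylor2_path oU Uz Cf urs e0.
exists (Num.min d1 d2); first by rewrite lt_min d10.
move=> m w; rewrite lt_min => /and3P[m0 md1 md2] wm.
have := T1 m (rcoord w); rewrite m0 md1 => /(_ isT wm) {}T1.
have := T2 m (rcoord w); rewrite m0 md2 => /(_ isT wm) {}T2.
rewrite /rcomb !big_rev /s rcoordE in T2; rewrite /rcomb /s rcoordE in T1.
have := quadratic_path_rev (partial2 f z) s (rcoord w); rewrite /s => E.
rewrite /taylor_lin /taylor_bil -E.
set q1 := quadratic_path _ _ _ in T1 *.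
set q2 := quadratic_path _ _ _ in T2 *.
rewrite (_ : _ - _ = 2^-1 * (f (z + w) - f z - \sum_i partial1 f z i * rcoord w i - q1) +
  2^-1 * (f (z + w) - f z - \sum_i partial1 f z i * rcoord w i - q2)); last by field.
apply: le_trans (ler_normD _ _) _; rewrite !normrM [`|2^-1|]ger0_norm ?invr_ge0//.
lra.
Qed.

(** * The Levi form *)

Lemma rpartial_cst (R : realType) n (v : 'rV[R[i]]_n) (c : R) z :
  rpartial v (fun=> c) z = 0.
Proof. by rewrite /rpartial derive1E; exact: derive_cst. Qed.

Lemma rpartialZ (R : realType) n (v : 'rV[R[i]]_n) (c : R) f z :
  derivable (line_fun v f z) 0 1 ->
  rpartial v (fun w => c * f w) z = c * rpartial v f z.
Proof.
move=> df; rewrite /rpartial !derive1E.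
exact: (@deriveZ _ _ _ (line_fun v f z) c 0 1 df).
Qed.

Lemma d_dzbarE (R : realType) n (l : 'I_n) (f : 'rV[R[i]]_n -> R) z :
  d_dzbar l (fun w => (f w)%:C) z =
  (2^-1 * partial1 f z (l, false)) +i* (2^-1 * partial1 f z (l, true)).
Proof.
rewrite /d_dzbar /cpartial /= !rpartial_cst /partial1 /rdir /=.
set a := rpartial _ _ _; set b := rpartial _ _ _.
have -> : (2 : R[i]) = (2 : R)%:C by rewrite rmorph_nat.
rewrite -fmorphV /=; apply/eqP; rewrite eq_complex /=; apply/andP; split; apply/eqP; ring.
Qed.

(** Wirtinger derivatives multiplied out:
    4 d_z d_zbar = (d_x - i d_y) (d_x + i d_y), without commuting the factors. *)
Lemma complex_hessianE (R : realType) n (U : set 'rV[R[i]]_n) f z k l :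
  Ck_on 2 U f -> U z ->
  complex_hessian f z k l =
    (4^-1 * (partial2 f z (k, false) (l, false) + partial2 f z (k, true) (l, true))) +i*
    (4^-1 * (partial2 f z (k, false) (l, true) - partial2 f z (k, true) (l, false))).
Proof.
move=> Cf Uz; rewrite mxE.
have dD i j : derivable (line_fun (rdir R i) (rpartial (rdir R j) f) z) 0 1.
  exact: Ck_on_derivable (Ck_on_partial1 j Cf) Uz.
have part i j : rpartial (rdir R i) (fun w => 2^-1 * partial1 f w j) z = 2^-1 * partial2 f z i j.
  exact: (rpartialZ _ (dD i j)).
have dE : d_dzbar l (fun w => (f w)%:C) =
    fun w => (2^-1 * partial1 f w (l, false)) +i* (2^-1 * partial1 f w (l, true)).
  by apply/funext => w; exact: d_dzbarE.
have cpart i : cpartial (rdir R i) (d_dzbar l (fun w => (f w)%:C)) z =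
    (2^-1 * partial2 f z i (l, false)) +i* (2^-1 * partial2 f z i (l, true)).
  have dRe : (fun w => complex.Re (d_dzbar l (fun w => (f w)%:C) w)) =
      (fun w => 2^-1 * partial1 f w (l, false)).
    by apply/funext => w; rewrite d_dzbarE.
  have dIm : (fun w => complex.Im (d_dzbar l (fun w => (f w)%:C) w)) =
      (fun w => 2^-1 * partial1 f w (l, true)).
    by apply/funext => w; rewrite d_dzbarE.
  rewrite /cpartial dRe dIm.
  congr (_ +i* _).
    exact: part.
  exact: part.
rewrite /d_dz (cpart (k, false)) (cpart (k, true)).
move: (partial2 f z (k, false) (l, false)) (partial2 f z (k, false) (l, true))
  (partial2 f z (k, true) (l, false)) (partial2 f z (k, true) (l, true)) => p q r s.
have -> : (2 : R[i]) = (2 : R)%:C by rewrite rmorph_nat.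
rewrite -fmorphV /=; apply/eqP; rewrite eq_complex /=; apply/andP.
split; apply/eqP; by field.
Qed.

(** Pairing [b] with [i b] cancels the part of the real Hessian that is the real
    part of a complex quadratic form, and leaves the Hermitian part. *)
Lemma taylor_bil_levi (R : realType) n (U : set 'rV[R[i]]_n) f z (b : 'rV[R[i]]_n) :
  Ck_on 2 U f -> U z ->
  taylor_bil f z b b + taylor_bil f z ((0 +i* 1) *: b) ((0 +i* 1) *: b) =
  2 * complex.Re ((b *m complex_hessian f z *m b ^t*%sesqui) ord0 ord0).
Proof.
move=> Cf Uz; rewrite mxE /taylor_bil -mulrDr -big_split /=.
have -> : complex.Re (\sum_j (b *m complex_hessian f z) ord0 j * (b ^t*%sesqui) j ord0) =
    \sum_(l < n) \sum_(k < n)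
      complex.Re (b ord0 k * complex_hessian f z k l * ((b ord0 l)^*)%C).
  rewrite raddf_sum; apply: eq_bigr => l _; rewrite !mxE mulr_suml raddf_sum.
  by apply: eq_bigr => k _.
rewrite exchange_big /= sum_rcoord mulr_sumr mulr_sumr; apply: eq_bigr => k _.
rewrite -!big_split /= sum_rcoord !mulr_sumr; apply: eq_bigr => l _.
rewrite (complex_hessianE _ _ Cf Uz) /rcoord /= !mxE.
move: (partial2 f z (k, false) (l, false)) (partial2 f z (k, false) (l, true))
  (partial2 f z (k, true) (l, false)) (partial2 f z (k, true) (l, true)) => p q r s.
case: (b ord0 k) => b1 b2; case: (b ord0 l) => c1 c2 /=.
by field.
Qed.

(** * Adding a quadratic polynomial to a plurisubharmonic function *)

(** The trigonometric polynomials to which a real quadratic polynomial restricts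
    on a circle. *)
Lemma Rintegral_trigonometric (R : realType) (c0 a b p r s : R) :
  Rintegral (@lebesgue_measure R) `[0, 2 * pi]
    (fun t : R => c0 + a * cos t + b * sin t +
       (p * cos t ^+ 2 + r * (cos t * sin t) + s * sin t ^+ 2)) =
  2 * pi * c0 + pi * (p + s).
Proof.
pose f (t : R) : R := c0 + a * cos t + b * sin t +
  (p * cos t ^+ 2 + r * (cos t * sin t) + s * sin t ^+ 2).
(* Antiderivative of [f]; cos ^ 2 and sin ^ 2 are integrated by means of
   sin * cos. *)
pose F (t : R) : R := c0 * t + a * sin t - b * cos t +
  (p / 2 * (t + sin t * cos t) + r / 2 * sin t ^+ 2 + s / 2 * (t - sin t * cos t)).
have dF (t : R) : is_derive t 1 F (f t).
  apply: is_derive_eq; rewrite /GRing.scale /= /f.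
  have := cos2Dsin2 t; move: (cos t) (sin t) => x y xy.
  apply/eqP; rewrite -subr_eq0.
  rewrite (_ : _ - _ = (1 - (x ^+ 2 + y ^+ 2)) * ((p + s) / 2)); last by field.
  by rewrite xy subrr mul0r.
have cf : continuous f.
  have cc := @continuous_cos R; have cs := @continuous_sin R.
  move=> t; apply: cvgD; [apply: cvgD; [apply: cvgD|]|apply: cvgD; [apply: cvgD|]].
  - exact: cvg_cst.
  - by apply: cvgMl_tmp; exact: cc.
  - by apply: cvgMl_tmp; exact: cs.
  - by apply: cvgMl_tmp; apply: cvgM; exact: cc.
  - by apply: cvgMl_tmp; apply: cvgM; [exact: cc|exact: cs].
  - by apply: cvgMl_tmp; apply: cvgM; exact: cs.
have cF : continuous F.
  move=> t; apply: differentiable_continuous; apply/derivable1_diffP.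
  by case: (dF t).
have pi20 : 0 < 2 * pi :> R by rewrite mulr_gt0// pi_gt0.
rewrite /Rintegral (@continuous_FTC2 _ f F 0 (2 * pi))//.
- rewrite /= /F mulr_natl sin2pi cos2pi sin0 cos0; by field.
- exact: continuous_subspaceT.
- split.
  + by move=> t _; case: (dF t).
  + by apply: cvg_at_right_filter; exact: cF.
  + by apply: cvg_at_left_filter; exact: cF.
- by move=> t _; rewrite derive1E; exact: derive_val.
Qed.

Lemma add_complex_scale (R : realType) n (a b : 'rV[R[i]]_n) (c s : R) :
  a + (c +i* s) *: b = a + c%:C *: b + s%:C *: ((0 +i* 1) *: b).
Proof.
rewrite scalerA -addrA -scalerDl; congr (_ + _ *: _).
apply/eqP; rewrite eq_complex /=; apply/andP; split; apply/eqP; ring.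
Qed.

Lemma continuous_circle (R : realType) n (a b : 'rV[R[i]]_n) :
  continuous (fun t : R => a + (cos t +i* sin t) *: b).
Proof.
move=> t; apply: cvg_rcoord => i.
have E (s : R) : rcoord (a + (cos s +i* sin s) *: b) i =
    rcoord a i + cos s * rcoord b i + sin s * rcoord ((0 +i* 1) *: b) i.
  have lr := @rlinear_rcoord R n i.
  by rewrite add_complex_scale !(rlinearD _ _ lr) !(rlinearZ _ _ lr).
rewrite E; under eq_cvg do rewrite E.
apply: cvgD; [apply: cvgD|]; first exact: cvg_cst.
- by apply: cvgMr_tmp; exact: continuous_cos.
- by apply: cvgMr_tmp; exact: continuous_sin.
Qed.

Lemma rlinear_shift_continuous (R : realType) n (f : 'rV[R[i]]_n -> R)
    (c : 'rV[R[i]]_n) :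
  rlinear f -> continuous (fun w : 'rV[R[i]]_n => f (w - c)).
Proof.
move=> lf z.
have -> : (fun w : 'rV[R[i]]_n => f (w - c)) = (fun w => f w - f c).
  by apply/funext => w; rewrite rlinearB.
have cz := @rlinear_continuous R n f lf z.
exact: cvgB cz (cvg_cst _).
Qed.

Lemma rbilinear_shift_continuous (R : realType) n
    (B : 'rV[R[i]]_n -> 'rV[R[i]]_n -> R) (c : 'rV[R[i]]_n) :
  (forall x, rlinear (B x)) -> (forall y, rlinear (B^~ y)) ->
  continuous (fun w : 'rV[R[i]]_n => B (w - c) (w - c)).
Proof.
move=> Br Bl z.
rewrite (_ : (fun w => _) =
    fun w : 'rV[R[i]]_n => \sum_i rcoord (w - c) i * B (rdir R i) (w - c)); last first.
  by apply/funext => w; rewrite (rlinearE (f := B^~ (w - c)) _ (Bl _)).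
have c1 i := @rlinear_shift_continuous R n _ c (@rlinear_rcoord R n i) z.
have c2 i := @rlinear_shift_continuous R n _ c (Br (rdir R i)) z.
apply: (@cvg_sumr _ _ _ (nbhs z)) => i.
exact: cvgM (c1 i) (c2 i).
Qed.

(** The quadratic polynomial satisfies the sub-mean value inequality because its
    mean over the circle spanned by [b] exceeds its value at the centre by
    (B b b + B (i b) (i b)) / 2. *)
Lemma continuous_psh_add_quadratic (R : realType) n (V : set 'rV[R[i]]_n) k
    (l : 'rV[R[i]]_n -> R) (B : 'rV[R[i]]_n -> 'rV[R[i]]_n -> R) (c : 'rV[R[i]]_n) :
  continuous_psh V k -> rlinear l ->
  (forall x, rlinear (B x)) -> (forall y, rlinear (B^~ y)) ->
  (forall b, 0 <= B b b + B ((0 +i* 1) *: b) ((0 +i* 1) *: b)) ->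
  continuous_psh V (fun w => k w + (l (w - c) + B (w - c) (w - c))).
Proof.
move=> [ck mk] ll Br Bl B0.
pose P (w : 'rV[R[i]]_n) := l (w - c) + B (w - c) (w - c).
have cP : continuous P.
  move=> z; have c1 := @rlinear_shift_continuous R n _ c ll z.
  have c2 := @rbilinear_shift_continuous R n _ c Br Bl z.
  exact: cvgD c1 c2.
split=> [z Vz|a b abV].
  have kz := ck z Vz; have Pz := cP z.
  exact: cvgD kz Pz.
pose gam (t : R) := a + (cos t +i* sin t) *: b.
have gamV t : V (gam t).
  by apply: abV; rewrite normc_def /= cos2Dsin2 sqrtr1.
have ckg : continuous (k \o gam).
  move=> t; apply: continuous_comp; first exact: continuous_circle.
  exact: ck.
have cPg : continuous (P \o gam).
  move=> t; apply: continuous_comp; first exact: continuous_circle.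
  exact: cP.
have int f : continuous f -> (@lebesgue_measure R).-integrable `[0, 2 * pi] (EFin \o f).
  move=> cf; apply: continuous_compact_integrable; first exact: segment_compact.
  exact: continuous_subspaceT.
have intE : Rintegral (@lebesgue_measure R) `[0, 2 * pi]
      (fun t => (k \o gam) t + (P \o gam) t) =
    Rintegral lebesgue_measure `[0, 2 * pi] (k \o gam) +
    Rintegral lebesgue_measure `[0, 2 * pi] (P \o gam).
  by apply: RintegralD; [exact: measurable_itv|exact: int|exact: int].
suff : k a + P a <= (2 * pi)^-1 *
    (Rintegral lebesgue_measure `[0, 2 * pi] (k \o gam) +
     Rintegral lebesgue_measure `[0, 2 * pi] (P \o gam)) by rewrite -intE.
pose b' := (0 +i* 1 : R[i]) *: b.
pose p1 := l b + B (a - c) b + B b (a - c).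
pose p2 := l b' + B (a - c) b' + B b' (a - c).
pose p3 := B b b' + B b' b.
have PE t : P (gam t) = P a + p1 * cos t + p2 * sin t +
   (B b b * cos t ^+ 2 + p3 * (cos t * sin t) + B b' b' * sin t ^+ 2).
  rewrite /P /gam add_complex_scale -/b' /p1 /p2 /p3.
  rewrite -addrA addrAC addrA; set d := a - c.
  have lB x y := rlinearD x y (Br _); have lB' x y z := rlinearD x y (Bl z).
  have lZ t' x z := rlinearZ t' x (Br z); have lZ' t' x z := rlinearZ t' x (Bl z).
  rewrite /= in lB' lZ'.
  rewrite !(rlinearD _ _ ll) !(rlinearZ _ _ ll) !(lB, lB') !(lZ, lZ').
  ring.
have -> : Rintegral lebesgue_measure `[0, 2 * pi] (P \o gam) =
    2 * pi * P a + pi * (B b b + B b' b').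
  rewrite -(Rintegral_trigonometric (P a) p1 p2 (B b b) p3 (B b' b')).
  by apply: eq_Rintegral => t _; exact: PE.
have := mk a b abV; rewrite -/gam => mka.
have pi0 := pi_gt0 R.
rewrite mulrDr lerD//.
rewrite -[leLHS](mulKf (lt0r_neq0 (mulr_gt0 (ltr0n R 2) pi0))).
rewrite ler_pM2l ?invr_gt0 ?mulr_gt0//.
by rewrite lerDl mulr_ge0// ltW.
Qed.

(** * Quadratic minorants on a slice *)

Lemma rlinear_sub (R : realType) n (f g : 'rV[R[i]]_n -> R) :
  rlinear f -> rlinear g -> rlinear (fun w => f w - g w).
Proof. by move=> lf lg t x y; rewrite lf lg; ring. Qed.

Lemma rlinear_lincomb (R : realType) n (I : Type) (s : seq I) (a : I -> R)
    (f : I -> 'rV[R[i]]_n -> R) :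
  (forall i, rlinear (f i)) -> rlinear (fun w => \sum_(i <- s) a i * f i w).
Proof.
move=> lf t x y; rewrite mulr_sumr -big_split /=; apply: eq_bigr => i _.
by rewrite lf; ring.
Qed.

Lemma rlinear_taylor_lin (R : realType) n (f : 'rV[R[i]]_n -> R) z :
  rlinear (taylor_lin f z).
Proof. by apply: rlinear_lincomb => i; exact: rlinear_rcoord. Qed.

Lemma rlinear_taylor_bil_r (R : realType) n (f : 'rV[R[i]]_n -> R) z x :
  rlinear (taylor_bil f z x).
Proof.
move=> t y y'; rewrite /taylor_bil.
have E w : \sum_i \sum_j partial2 f z i j * rcoord x i * rcoord w j =
    \sum_i 1 * (\sum_j partial2 f z i j * rcoord x i * rcoord w j).
  by apply: eq_bigr => i _; rewrite mul1r.
rewrite !E.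
rewrite (rlinear_lincomb _ _ (f := fun i w =>
    \sum_j partial2 f z i j * rcoord x i * rcoord w j)); first by ring.
by move=> i; apply: rlinear_lincomb => j; exact: rlinear_rcoord.
Qed.

Lemma rlinear_taylor_bil_l (R : realType) n (f : 'rV[R[i]]_n -> R) z y :
  rlinear (fun x => taylor_bil f z x y).
Proof.
move=> t x x'; rewrite /taylor_bil.
have E w : \sum_i \sum_j partial2 f z i j * rcoord w i * rcoord y j =
    \sum_i (\sum_j partial2 f z i j * rcoord y j) * rcoord w i.
  by apply: eq_bigr => i _; rewrite mulr_suml; apply: eq_bigr => j _; ring.
rewrite !E.
rewrite (rlinear_lincomb _ _ (f := fun i w => rcoord w i)); first by ring.
by move=> i; exact: rlinear_rcoord.
Qed.

Lemma rcoord_mul_bound (R : realType) m n (L : 'M[R[i]]_(m, n)) :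
  exists2 M : R, 0 < M & forall (d : 'rV[R[i]]_m) i,
    `|rcoord (d *m L) i| <= M * enorm d.
Proof.
pose c i := \sum_j `|rcoord (rdir R j *m L) i|.
have c0 i : 0 <= c i by apply: sumr_ge0.
exists (\sum_i c i + 1) => [|d i].
  by rewrite ltr_wpDl// sumr_ge0.
rewrite (rlinearE d (rlinear_comp L (@rlinear_rcoord R n i))).
apply: (le_trans (ler_norm_sum _ _ _)).
apply: (@le_trans _ _ (c i * enorm d)).
  rewrite /c mulr_suml; apply: ler_sum => j _; rewrite normrM mulrC.
  by rewrite ler_wpM2l// rcoord_le_enorm.
rewrite ler_wpM2r ?enorm_ge0// (bigD1 i)//= -addrA lerDl addr_ge0//.
by rewrite sumr_ge0.
Qed.

Lemma taylor2_slice (R : realType) m n (L : 'M[R[i]]_(m, n)) (U : set 'rV[R[i]]_n) f z :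
  open U -> U z -> Ck_on 2 U f ->
  forall e : R, 0 < e -> exists2 r : R, 0 < r & forall d, enorm d < r ->
    `|f (z + d *m L) - f z - taylor_lin f z (d *m L) -
      taylor_bil f z (d *m L) (d *m L)| <= e * enorm d ^+ 2.
Proof.
move=> oU Uz Cf e e0; have [M M0 LM] := rcoord_mul_bound L.
have eM0 : 0 < e / M ^+ 2 by rewrite divr_gt0// exprn_gt0.
have [r r0 rT] := taylor2 oU Uz Cf eM0.
exists (r / M) => [|d dr]; first by rewrite divr_gt0.
have := rT (M * enorm d) (d *m L).
rewrite mulr_ge0 ?enorm_ge0 ?(ltW M0)//= mulrC -ltr_pdivlMr// dr => /(_ isT).
rewrite mulrC exprMn mulrA divfK ?expf_neq0 ?gt_eqF//; apply => i.
exact: LM.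
Qed.

Lemma psd_mx_levi (R : realType) n (M N A : 'M[R[i]]_n) (b : 'rV[R[i]]_n) :
  psd_mx (M - A) -> psd_mx (A - N) ->
  complex.Re ((b *m N *m b ^t*%sesqui) ord0 ord0) <=
  complex.Re ((b *m M *m b ^t*%sesqui) ord0 ord0).
Proof.
move=> [_ /(_ b) p1] [_ /(_ b) p2]; have := addr_ge0 p1 p2.
have -> : (b *m (M - A) *m b ^t*%sesqui) ord0 ord0 +
    (b *m (A - N) *m b ^t*%sesqui) ord0 ord0 =
    (b *m M *m b ^t*%sesqui) ord0 ord0 - (b *m N *m b ^t*%sesqui) ord0 ord0.
  rewrite !mulmxBr !mulmxBl; move: (_ *m M *m _) (_ *m N *m _) (_ *m A *m _).
  by move=> M' N' A'; rewrite 4!mxE addrA subrK.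
case: ((b *m M *m _) ord0 ord0) => a1 a2; case: ((b *m N *m _) ord0 ord0) => b1 b2.
by rewrite lecE /= subr_ge0 => /andP[].
Qed.

(** The difference of the two Taylor polynomials.  Its Levi form is the sum of
    those of M - A and A - N, for M and N the two complex Hessians; the matrix
    [A] serves as a common bound for Hessians taken at different points. *)
Lemma quadratic_minorant (R : realType) m n (L : 'M[R[i]]_(m, n))
    (A : 'M[R[i]]_n) (U W : set 'rV[R[i]]_n) (g h : 'rV[R[i]]_n -> R) x y :
  open U -> open W -> U x -> W y -> Ck_on 2 U g -> Ck_on 2 W h ->
  psd_mx (complex_hessian g x - A) -> psd_mx (A - complex_hessian h y) ->
  exists (l : 'rV[R[i]]_m -> R) (B : 'rV[R[i]]_m -> 'rV[R[i]]_m -> R),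
    [/\ rlinear l, forall v, rlinear (B v), forall w, rlinear (B^~ w),
        forall b, 0 <= B b b + B ((0 +i* 1) *: b) ((0 +i* 1) *: b) &
        forall e : R, 0 < e -> exists2 r : R, 0 < r & forall d, enorm d < r ->
          g x - h y + (l d + B d d) - e * enorm d ^+ 2 <=
          g (x + d *m L) - h (y + d *m L)].
Proof.
move=> oU oW Ux Wy Cg Ch pg ph.
exists (fun d => taylor_lin g x (d *m L) - taylor_lin h y (d *m L)).
exists (fun d d' => taylor_bil g x (d *m L) (d' *m L) -
                    taylor_bil h y (d *m L) (d' *m L)).
split.
- apply: rlinear_sub; apply: rlinear_comp; exact: rlinear_taylor_lin.
- move=> v; apply: rlinear_sub.
    exact: (rlinear_comp L (rlinear_taylor_bil_r g x (v *m L))).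
  exact: (rlinear_comp L (rlinear_taylor_bil_r h y (v *m L))).
- move=> v; apply: rlinear_sub.
    exact: (rlinear_comp L (rlinear_taylor_bil_l g x (v *m L))).
  exact: (rlinear_comp L (rlinear_taylor_bil_l h y (v *m L))).
- move=> b; rewrite -scalemxAl addrACA -opprD.
  have Lg := taylor_bil_levi (b *m L) Cg Ux; have Lh := taylor_bil_levi (b *m L) Ch Wy.
  rewrite [X in X - _]Lg [X in _ - X]Lh.
  by rewrite -mulrBr mulr_ge0// subr_ge0; exact: psd_mx_levi pg ph.
- move=> e e0; have e20 : 0 < e / 2 by rewrite divr_gt0.
  have [r1 r10 T1] := taylor2_slice L oU Ux Cg e20.
  have [r2 r20 T2] := taylor2_slice L oW Wy Ch e20.
  exists (Num.min r1 r2) => [|d]; first by rewrite lt_min r10.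
  rewrite lt_min => /andP[/T1 {}T1 /T2 {}T2].
  move: T1 T2.
  move: (taylor_lin g x _) (taylor_bil g x _ _) (g (x + _)) => l1 b1 g1.
  move: (taylor_lin h y _) (taylor_bil h y _ _) (h (y + _)) => l2 b2 h1.
  by rewrite !ler_norml => /andP[? ?] /andP[? ?]; lra.
Qed.

(** * Perturbation to a strict interior maximum *)

Lemma usc_on_subset (R : realType) n (X Y : set 'rV[R[i]]_n) u :
  Y `<=` X -> usc_on X u -> usc_on Y u.
Proof.
move=> YX [u1 u2]; split=> [x /YX /u1//|x /YX Xx a /(u2 _ Xx)].
rewrite /within /=; apply: (@filterS _ (nbhs x) _) => y H Yy; apply: H; exact: YX.
Qed.

Lemma usc_on_add (R : realType) n (X : set 'rV[R[i]]_n) u (k : 'rV[R[i]]_n -> R) :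
  usc_on X u -> (forall x, X x -> {for x, continuous k}) ->
  usc_on X (fun x => u x + (k x)%:E)%E.
Proof.
move=> [u1 u2] ck; split=> [x Xx|x Xx a].
  by rewrite lte_add_pinfty// ?ltry// u1.
rewrite -lteBrDr// -EFinB => /lte_real_between[b /andP[ub]].
rewrite lte_fin => ba.
have nu := u2 x Xx b ub.
have nk : \forall y \near nbhs x, `|k y - k x| < a - k x - b.
  by have /cvgr_distC_lt := ck x Xx; apply; rewrite subr_gt0.
have nk' : \forall y \near within X (nbhs x), `|k y - k x| < a - k x - b.
  exact: cvg_within nk.
apply: filterS2 nu nk' => y uy ky; rewrite -lteBrDr// -EFinB.
apply: lt_le_trans uy _; rewrite lee_fin.
by move: ky; rewrite ltr_norml => /andP[? ?]; lra.
Qed.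

Lemma usc_on_slice (R : realType) m n (X : set 'rV[R[i]]_n) u p
    (L : 'M[R[i]]_(m, n)) :
  usc_on X u -> usc_on [set w | X (p + w *m L)] (fun w => u (p + w *m L)).
Proof.
move=> [u1 u2]; split=> [w|w Xw a ua]; first exact: u1.
have cphi : (p + w' *m L) @[w' --> w] --> p + w *m L.
  apply: (@cvg_rcoord _ _ _ (nbhs w)) => i.
  have lr := @rlinear_rcoord R n i.
  rewrite (rlinearD _ _ lr); under eq_cvg do rewrite (rlinearD _ _ lr).
  have lc := @rlinear_continuous R m _ (rlinear_comp L lr) w.
  exact: cvgD (cvg_cst _) lc.
exact: cphi _ (u2 _ Xw a ua).
Qed.

(** If the maximum over the ball beats the maximum over the sphere by some gap,
    a multiple of the squared distance to the centre that stays below the gap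
    on the sphere leaves the maximum in the interior. *)
Lemma strict_interior_max (R : realType) n (c : 'rV[R[i]]_n.+1) (r : R) F :
  0 < r -> usc_on (eclosed_ball c r) F ->
  (exists2 b, esphere c r b & forall x, eclosed_ball c r x -> (F x <= F b)%E) \/
  (exists e w, [/\ 0 < e, enorm (w - c) < r, (-oo < F w)%E &
     forall x, eclosed_ball c r x ->
       (F x + (e * enorm (x - c) ^+ 2)%:E <= F w + (e * enorm (w - c) ^+ 2)%:E)%E]).
Proof.
move=> r0 uscF.
have SK : esphere c r `<=` eclosed_ball c r.
  by move=> z; rewrite /esphere /eclosed_ball /= => ->.
have [b Sb maxb] := usc_on_max uscF SK (@compact_esphere R n.+1 c r (ltW r0))
  (esphere_nonempty c (ltW r0)).
have [bK|/existsNP[x /not_implyP[Kx /negP]]] :=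
  pselect (forall x, eclosed_ball c r x -> (F x <= F b)%E); first by left; exists b.
rewrite -ltNge => /lte_real_between[t /andP[bt /lte_real_between[t' /andP[]]]].
rewrite lte_fin => tt' t'x; right.
(* The added term equals t' - t on the sphere. *)
pose e := (t' - t) / r ^+ 2.
have e0 : 0 < e by rewrite divr_gt0 ?subr_gt0 ?exprn_gt0.
have uscG : usc_on (eclosed_ball c r) (fun x => F x + (e * enorm (x - c) ^+ 2)%:E)%E.
  apply: usc_on_add => // z _.
  have cz := @enorm_sqr_continuous R n.+1 c z.
  exact: cvgMl_tmp cz.
have [w Kw maxw] := usc_on_max uscG (@subset_refl _ _)
  (@compact_eclosed_ball R n.+1 c r (ltW r0)) (ex_intro _ x Kx).
have t'w : (t'%:E < F w + (e * enorm (w - c) ^+ 2)%:E)%E.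
  apply: lt_le_trans t'x _; apply: le_trans (maxw x Kx).
  by rewrite leeDl// lee_fin mulr_ge0 ?sqr_ge0// ltW.
exists e, w; split => //.
  rewrite lt_neqAle Kw andbT; apply/eqP => wr.
  move: t'w; rewrite wr /e divfK ?gt_eqF ?exprn_gt0//; apply/negP; rewrite -leNgt.
  rewrite -leeBrDr// -EFinB subKr; apply: le_trans (maxb w wr) _.
  exact: ltW.
by case: (F w) t'w => [s||] //= _; rewrite ltNyr.
Qed.

(** * Sup-convolutions *)

Definition rdot (R : realType) n (v w : 'rV[R[i]]_n) : R :=
  \sum_i rcoord v i * rcoord w i.

Lemma rlinear_rdot (R : realType) n (v : 'rV[R[i]]_n) : rlinear (rdot v).
Proof. by apply: rlinear_lincomb => i; exact: rlinear_rcoord. Qed.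

Lemma enorm_sqrD (R : realType) n (v w : 'rV[R[i]]_n) :
  enorm (v + w) ^+ 2 = enorm v ^+ 2 + 2 * rdot v w + enorm w ^+ 2.
Proof.
rewrite !enorm_sqr /rdot mulr_sumr -!big_split; apply: eq_bigr => i _ /=.
by rewrite (rlinearD _ _ (@rlinear_rcoord R n i)); ring.
Qed.

Lemma nbhs_enorm (R : realType) n (z : 'rV[R[i]]_n) P :
  nbhs z P -> exists2 d : R, 0 < d & forall w, enorm w < d -> P (z + w).
Proof.
move=> /nbhs_rcoord[d d0 dP]; exists d => // w wd; apply: dP => i.
by rewrite addrAC subrr add0r; apply: le_lt_trans wd; exact: rcoord_le_enorm.
Qed.

Lemma nbhs_slice (R : realType) m n (X : set 'rV[R[i]]_n) z (L : 'M[R[i]]_(m, n)) :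
  open X -> X z -> exists2 d : R, 0 < d & forall w, enorm w < d -> X (z + w *m L).
Proof.
move=> oX Xz.
have /nbhs_rcoord[d d0 dX] : nbhs z X by apply: open_nbhs_nbhs.
have [M M0 LM] := rcoord_mul_bound L.
exists (d / M) => [|w wd]; first by rewrite divr_gt0.
apply: dX => i; rewrite addrAC subrr add0r; apply: le_lt_trans (LM _ _) _.
by rewrite mulrC -ltr_pdivlMr.
Qed.

Theorem proposition4p1 (R : realType) (n : nat)
    (Phi : 'rV[R[i]]_n -> \bar R) (Phi_usc : usc_on setT Phi)
    (U : set 'rV[R[i]]_n) (U_open : open U) (U_nonempty : U !=set0)
    (A : 'M[R[i]]_n) (A_herm : A \is hermsymmx)
    (g : 'rV[R[i]]_n -> R) (g_C2 : Ck_on 2 U g)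
    (g_hess : forall z, U z -> psd_mx (complex_hessian g z - A))
    (q : nat) (u : 'rV[R[i]]_n -> \bar R) (u_psh : psh_q q U u) :
  let v := fun x => (u x + (g x)%:E)%E in
  let W := interior (proper_set U Phi v) in
  W !=set0 ->
  usc_on W (supconv U Phi v) ->
  forall h : 'rV[R[i]]_n -> R,
    Ck_on 2 W h ->
    (forall z, W z -> psd_mx (A - complex_hessian h z)) ->
    psh_q q W (fun y => (supconv U Phi v y - (h y)%:E)%E).
Proof.
move=> v W _ S_usc h h_C2 h_hess.
set S := supconv U Phi v in S_usc *.
have W_open : open W by exact: open_interior.
have Sh_usc : usc_on W (fun y => (S y - (h y)%:E)%E).
  have -> : (fun y => (S y - (h y)%:E)%E) = (fun y => (S y + (- h y)%:E)%E).
    by apply/funext => y; rewrite EFinN.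
  apply: usc_on_add => // y Wy; have hy := h_C2.1 y Wy.
  exact: cvgN hy.
split=> [//|qn p L L_unitary]; right => c r r0 BW V k V_open BV k_psh.
pose F (w : 'rV[R[i]]_q.+1) :=
  (S (p + w *m L)%R - (h (p + w *m L)%R)%:E + (k w)%:E)%E.
have F_usc : usc_on (eclosed_ball c r) F.
  apply: usc_on_add => [|w /BV Vw]; last exact: k_psh.1.
  by apply: usc_on_subset BW _; exact: usc_on_slice Sh_usc.
have [//|[e [w [e0 wr Fw maxw]]]] := strict_interior_max r0 F_usc.
exfalso.
have Kw : eclosed_ball c r w by exact: ltW.
have Ww : W (p + w *m L) by exact: BW.
have [x Ux Sx] := interior_subset Ww.
set y := p + w *m L in Ww Sx; rewrite -/S in Sx.
have [l [B [l_lin B_linr B_linl B_levi minorant]]] :=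
  quadratic_minorant L U_open W_open Ux Ww g_C2 h_C2 (g_hess x Ux) (h_hess y Ww).
have e20 : 0 < e / 2 by rewrite divr_gt0.
have [r1 r10 minor] := minorant _ e20.
have [r2 r20 xU] := nbhs_slice L U_open Ux.
have [r3 r30 wB] : exists2 d : R, 0 < d &
    forall d', enorm d' < d -> eclosed_ball c r (w + d').
  apply: nbhs_enorm.
  have nw : \forall z \near nbhs w, enorm (z - c) ^+ 2 < r ^+ 2.
    have cw := @enorm_sqr_continuous R q.+1 c w.
    apply: (cvgr_lt _ cw).
    by rewrite ltr_sqr ?nnegrE ?enorm_ge0// ltW.
  apply: (@filterS _ (nbhs w) _ _ _ _ nw) => z.
  by rewrite ltr_sqr ?nnegrE ?enorm_ge0 ?(ltW r0)// => /ltW.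
pose rho := Num.min r1 (Num.min r2 r3) / 2.
have m0 : 0 < Num.min r1 (Num.min r2 r3) by rewrite !lt_min r10 r20.
have rho0 : 0 < rho by rewrite divr_gt0.
have [rho1 rho2 rho3] : [/\ rho < r1, rho < r2 & rho < r3].
  have : rho < Num.min r1 (Num.min r2 r3) by rewrite ltr_pdivrMr// ltr_pMr// ltr1n.
  by rewrite !lt_min => /and3P[].
have slice d : x - w *m L + (w + d) *m L = x + d *m L.
  by rewrite mulmxDl addrA subrK.
(* The slice through [x] parallel to the given one, parametrized so that
   [w] corresponds to [x]. *)
have u_slice := u_psh.2 qn (x - w *m L) L L_unitary.
(* |w + d - c|^2 = |w - c|^2 + 2 <w - c, d> + |d|^2: the linear part of the
   perturbation joins [l]; half of |d|^2 absorbs the Taylor remainder, and the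
   other half makes the maximum strict. *)
pose l' (d : 'rV[R[i]]_q.+1) := l d + 2 * e * rdot (w - c) d.
have l'_lin : rlinear l'.
  by move=> t a b; rewrite /l' l_lin rlinear_rdot; ring.
pose H (z : 'rV[R[i]]_q.+1) := k z + (l' (z - w) + B (z - w) (z - w)).
have H_psh : continuous_psh V H by exact: continuous_psh_add_quadratic.
have ltu z : U z -> (u z < +oo)%E by exact: u_psh.1.1.
have u_fin : exists a : R, u x = a%:E.
  move: Fw; rewrite /F -/y Sx /v.
  by have := ltu x Ux; case: (u x) => [a||] // _ _; exists a.
have [a ux] := u_fin.
have Phi_fin : exists a : R, Phi (y - x) = a%:E.
  move: Fw; rewrite /F -/y Sx /v ux.
  by have := Phi_usc.1 (y - x) I; case: (Phi _) => [b||] // _ _; exists b.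
have [b Phib] := Phi_fin.
have ball_shift z : eclosed_ball w rho z ->
    enorm (z - w) < r1 /\ enorm (z - w) < r2 /\ enorm (z - w) < r3.
  rewrite /eclosed_ball /= => zr.
  by split; [|split]; apply: le_lt_trans zr _.
have wz z : z = w + (z - w) by rewrite addrC subrK.
case: u_slice => [/(_ w)|/(_ w rho rho0)].
  by rewrite /= subrK ux => /(_ Ux).
have sub1 : eclosed_ball w rho `<=` [set z | U (x - w *m L + z *m L)].
  move=> z /ball_shift[_ [zr _]] /=; rewrite (wz z) slice; exact: xU.
have sub2 : eclosed_ball w rho `<=` V.
  by move=> z /ball_shift[_ [_ zr]]; apply: BV; rewrite (wz z); exact: wB.
move=> /(_ sub1 V H V_open sub2 H_psh)[z zrho maxz].
have wrho : eclosed_ball w rho w.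
  rewrite /eclosed_ball /= subrr -(ler_sqr (enorm_ge0 _) (ltW rho0)) enorm_sqr.
  rewrite big1 ?sqr_ge0// => i _.
  by rewrite (rlinear0 (@rlinear_rcoord R _ i)) expr0n.
have := maxz w wrho.
rewrite /= subrK ux /H subrr (rlinear0 l'_lin) (rlinear0 (B_linr _)) !addr0.
have zrho' : eclosed_ball w rho z by rewrite /eclosed_ball /= zrho.
have [zr1 [zr2 zr3]] := ball_shift z zrho'.
pose d := z - w; have zE : z = w + d := wz z.
have Ud : U (x + d *m L) by exact: xU.
have Kz : eclosed_ball c r z by rewrite zE; exact: wB.
rewrite -/d zE slice -zE.
have := ltu _ Ud.
have := maxw z Kz; rewrite /F -/y Sx /v ux Phib zE mulmxDl addrA -/y -zE.
(* The point [x + d *m L] competes in the supremum at [y + d *m L] with the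
   same shift y - x as [x] at [y]. *)
have Sge : (u (x + d *m L)%R + (g (x + d *m L)%R)%:E + b%:E <= S (y + d *m L)%R)%E.
  apply: ereal_sup_ubound; exists (x + d *m L) => //.
  by rewrite /v -Phib opprD addrACA subrr addr0.
have zc : z - c = w - c + d by rewrite zE addrAC.
have dn : enorm d = rho by [].
have := minor d zr1; rewrite zc (enorm_sqrD (w - c) d) dn.
have Wd : W (y + d *m L) by rewrite /y -addrA -mulmxDl -zE; exact: BW.
have := S_usc.1 (y + d *m L) Wd.
move: Sge; rewrite /l'.
move: (g (x + _)) (h (y + _)) (S (y + _)) (u (x + _)) (rdot _ _).
move: (l d) (B d d) => l1 B1 g1 h1 s1 u1 D.
move: (g x) (h y) (k z) (k w) (enorm _ ^+ 2) => g0 h0 k1 k0 N.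
case: u1 => [u1||] //; case: s1 => [s1||] //.
rewrite -!EFinN -!EFinD !lee_fin => Sge _ mino maxi _ sub.
have : 0 < e * rho ^+ 2 by rewrite mulr_gt0// exprn_gt0.
lra.
Qed.
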